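(* For every (finite, simple, undirected) graph $G$, $\dim_{\mathrm{TH}}(G) \leq 2(\mathrm{tw}(G)+1)$, where $\mathrm{tw}(G)$ denotes the treewidth of $G$.
   Context: A graph $G$ on $n$ vertices is a threshold graph if there exist real numbers $a_1,\dots,a_n,b$ such that the $0$-$1$ solutions of $\sum_{i=1}^n a_ix_i\le b$ are exactly the characteristic vectors of the cliques of $G$ (equivalently, $G$ has no induced subgraph isomorphic to $2K_2$, $P_4$ or $C_4$). For graphs $G_1,\dots,G_k$ on the same vertex set $V$, $G=G_1\cap\cdots\cap G_k$ means $V(G)=V$ and $E(G)=E(G_1)\cap\cdots\cap E(G_k)$. The threshold dimension $\dim_{\mathrm{TH}}(G)$ is the smallest $k$ such that there exist threshold graphs $G_1,\dots,G_k$ on $V(G)$ with $G=G_1\cap\cdots\cap G_k$. A tree decomposition of $G$ is a pair $(T,\{X_i: i\in V(T)\})$ with $T$ a tree and $X_i\subseteq V(G)$ such that $\bigcup_i X_i=V(G)$, every edge of $G$ has both ends in some $X_i$, and $X_i\cap X_k\subseteq X_j$ whenever $j$ lies on the $T$-path from $i$ to $k$; its width is $\max_i|X_i|-1$, and $\mathrm{tw}(G)$ is the minimum width of a tree decomposition of $G$. *)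

(* Defs.v *)
From HB Require Import structures.
From mathcomp Require Import all_boot all_order all_algebra.
From mathcomp Require Import boolp reals.

Set Implicit Arguments.
Unset Strict Implicit.
Unset Printing Implicit Defensive.

Import Order.TTheory GRing.Theory Num.Theory.

Record sgraph (V : finType) := SGraph {
  edge :> rel V;
  edge_sym : symmetric edge;
  edge_irr : irreflexive edge }.

Definition is_clique (V : finType) (G : sgraph V) (K : {set V}) : Prop :=
  {in K &, forall x y, x != y -> G x y}.

Definition is_threshold (R : realType) (V : finType) (G : sgraph V) : Prop :=
  exists (a : V -> R) (b : R), forall x : V -> R,
    (forall i, x i = 0%R \/ x i = 1%R) ->
    ((\sum_i a i * x i <= b)%R <->
     exists K : {set V}, is_clique G K /\ forall i, x i = ((i \in K)%:R)%R).

Definition is_intersection (V : finType) (G : sgraph V) (k : nat)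
    (Gs : 'I_k -> sgraph V) : Prop :=
  forall x y, G x y = [forall i, Gs i x y].

(* An intersection has at least one member, so a complete graph has
   threshold dimension 1, not 0. *)
Definition threshold_cover (R : realType) (V : finType) (G : sgraph V)
    (k : nat) : Prop :=
  0 < k /\
  exists Gs : 'I_k -> sgraph V,
    (forall i, is_threshold R (Gs i)) /\ is_intersection G Gs.

Definition is_tree (T : finType) (F : sgraph T) : Prop :=
  [/\ 0 < #|T|,
      forall i j, connect F i j
    & forall c : seq T, 2 < size c -> ~ ucycle F c].

(* The third clause ranges over all simple paths from i to k; in a tree there
   is exactly one. *)
Definition is_tree_decomposition (V T : finType) (G : sgraph V) (F : sgraph T)
    (X : T -> {set V}) : Prop :=
  [/\ is_tree F,
      \bigcup_i X i = [set: V],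
      forall u v, G u v -> exists i, u \in X i /\ v \in X i
    & forall (i k : T) (p : seq T), path F i p -> uniq (i :: p) ->
        last i p = k -> forall j, j \in i :: p -> X i :&: X k \subset X j].

(* Truncated predecessor: when V is empty the width is 0 instead of -1. *)
Definition bags_width (V T : finType) (X : T -> {set V}) : nat :=
  (\max_i #|X i|).-1.

Definition has_tree_decomposition_width (V : finType) (G : sgraph V)
    (w : nat) : Prop :=
  exists (T : finType) (F : sgraph T) (X : T -> {set V}),
    is_tree_decomposition G F X /\ bags_width X = w.

Section Nonadjacent.
Variables (V : finType) (G : sgraph V).

(* The complete graph minus the edge uv if u and v are distinct non-adjacent
   vertices of G, the complete graph otherwise. *)
Definition co_edge_rel (p : V * V) : rel V := fun x y =>
  (x != y) && ~~ [&& p.1 != p.2, ~~ G p.1 p.2 &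
    ((x == p.1) && (y == p.2)) || ((x == p.2) && (y == p.1))].

Lemma co_edge_sym p : symmetric (co_edge_rel p).
Proof.
move=> x y; rewrite /co_edge_rel eq_sym; congr (_ && ~~ [&& _, _ & _]).
by rewrite orbC andbC [X in _ || X]andbC.
Qed.

Lemma co_edge_irr p : irreflexive (co_edge_rel p).
Proof. by move=> x; rewrite /co_edge_rel eqxx. Qed.

Definition co_edge p := SGraph (co_edge_sym p) (co_edge_irr p).

Lemma co_edge_threshold (R : realType) p : is_threshold R (co_edge p).
Proof.
set c := (p.1 != p.2) && ~~ G p.1 p.2.
pose a (i : V) : R := if c then ((i == p.1) + (i == p.2))%:R%R else 0%R.
exists a, 1%R => x x01.
pose K := [set i | x i == 1%R].
have xK i : x i = ((i \in K)%:R)%R.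
  by rewrite inE; case: (x01 i) => ->; rewrite ?eqxx // eq_sym oner_eq0.
have KE (L : {set V}) : (forall i, x i = ((i \in L)%:R)%R) -> L = K.
  move=> xL; apply/setP => i; have := xL i; rewrite xK.
  case: (i \in K) (i \in L) => [] [] // /eqP.
    by rewrite oner_eq0.
  by rewrite eq_sym oner_eq0.
have sumE : (\sum_i a i * x i = (c * ((p.1 \in K) + (p.2 \in K)))%:R)%R.
  rewrite /a; case: (c); last by rewrite mul0n big1 // => i _; rewrite mul0r.
  under eq_bigr => i _ do rewrite natrD mulrDl.
  rewrite big_split /= mul1n natrD -!xK; congr (_ + _)%R.
    rewrite (bigD1 p.1) //= eqxx mul1r big1 ?addr0 // => i /negbTE ->.
    by rewrite mul0r.
  rewrite (bigD1 p.2) //= eqxx mul1r big1 ?addr0 // => i /negbTE ->.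
  by rewrite mul0r.
rewrite sumE (ler_nat R _ 1); split=> [le1|[L [cL /KE eLK]]].
  exists K; split=> // u v uK vK neq; rewrite /= /co_edge_rel neq /=.
  apply/negP => /and3P[n1 n2 n3]; move: le1; rewrite /c n1 n2.
  by case/orP: n3 => /andP[/eqP <- /eqP <-]; rewrite uK vK.
rewrite -eLK; case: (boolP c) => // /andP[n1 n2]; rewrite mul1n.
case: (boolP (p.1 \in L)) => p1; case: (boolP (p.2 \in L)) => p2 //.
by have := cL _ _ p1 p2 n1; rewrite /= /co_edge_rel n1 n2 !eqxx.
Qed.

Lemma co_edge_complete u x y : co_edge (u, u) x y = (x != y).
Proof. by rewrite /= /co_edge_rel /= eqxx andbT. Qed.

Lemma co_edgeP x y : reflect (x != y /\ forall p, co_edge p x y) (G x y).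
Proof.
apply: (iffP idP) => [Gxy|[nxy /(_ (x, y))]]; last first.
  by rewrite /= /co_edge_rel /= nxy !eqxx /= andbT negbK.
have nxy : x != y by apply: contraTneq Gxy => ->; rewrite edge_irr.
split=> // p; rewrite /= /co_edge_rel nxy /=; apply/negP => /and3P[_ nG].
by case/orP=> /andP[/eqP ex /eqP ey]; move: nG; rewrite -ex -ey ?Gxy // edge_sym Gxy.
Qed.

End Nonadjacent.

Lemma empty_threshold (R : realType) (V : finType) (G : sgraph V) :
  #|V| = 0 -> is_threshold R G.
Proof.
move=> V0; have noV (x : V) : False by have /card0_eq/(_ x) := V0.
exists (fun=> 0%R), 0%R => x _; split=> [_|_]; last first.
  by rewrite big1 // => i _; rewrite mul0r.
by exists set0; split=> [u|i]; [case: (noV u) | case: (noV i)].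
Qed.

Lemma threshold_cover_ex (R : realType) (V : finType) (G : sgraph V) :
  exists k, `[< threshold_cover R G k >].
Proof.
have [V0|Vgt0] := posnP #|V|.
  exists 1; apply/asboolP; split=> //; exists (fun=> G); split=> [_|x y].
    exact: empty_threshold.
  by have /card0_eq/(_ x) := V0.
exists #|{: V * V}|; apply/asboolP; split.
  by rewrite card_prod muln_gt0 Vgt0.
exists (fun i => co_edge G (enum_val i)); split=> [i|x y].
  exact: co_edge_threshold.
apply/co_edgeP/forallP => [[_ h] i|h]; first exact: h.
have h' p : co_edge G p x y by have := h (enum_rank p); rewrite enum_rankK.
by split=> //; rewrite -(co_edge_complete G x).
Qed.

Lemma has_tree_decomposition_width_ex (V : finType) (G : sgraph V) :
  exists w, `[< has_tree_decomposition_width G w >].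
Proof.
pose X (_ : unit) := [set: V]; exists (bags_width X); apply/asboolP.
have sF : symmetric (fun _ _ : unit => false) by [].
have iF : irreflexive (fun _ _ : unit => false) by [].
exists unit, (SGraph sF iF), X; split=> //; split.
- split=> [|[] []|]; [by rewrite card_unit | exact: connect0 |].
  by case=> [|[] [|[] c]] //= _ /andP[].
- by apply/setP => v; rewrite inE; apply/bigcupP; exists tt.
- by move=> u v _; exists tt; rewrite !inE.
- by move=> i k p _ _ _ j _; apply: subsetT.
Qed.

Definition threshold_dim (R : realType) (V : finType) (G : sgraph V) : nat :=
  ex_minn (threshold_cover_ex R G).

Definition treewidth (V : finType) (G : sgraph V) : nat :=
  ex_minn (has_tree_decomposition_width_ex G).

(* Main.v *)
(** Fill in each bag of a tree decomposition of width [w] to a clique, giving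
    a graph [H] that contains [G].  Building the tree one node at a time,
    colour the vertices properly with [w + 1] colours and order them linearly,
    inserting each new vertex immediately after the last of its neighbours.
    Then [a < b < v <= y] with [H a v] and [H b y] never happens for [a] and
    [b] of the same colour.

    For a colour class [C] and a direction of the order, join a vertex [x] of
    [C] to a vertex [z] outside [C] as soon as some [G]-neighbour of [z] in [C]
    is at [x] or beyond it.  With [C] independent and its complement a clique
    this is a threshold graph containing [G].  If [u < v] are non-adjacent in
    [G] and of distinct colours, then [uv] is an edge of both the graph of the
    colour of [v] (forward) and that of the colour of [u] (backward) only if
    [G b y] and [G a v] for [b = u], some [y >= v] and some [a < u] of the
    colour of [u], which is excluded. *)

Require Import Defs.
From mathcomp Require Import all_boot all_order all_algebra.
From mathcomp Require Import boolp reals zify.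

Set Implicit Arguments.
Unset Strict Implicit.
Unset Printing Implicit Defensive.

(** * Natural-number weights and threshold split graphs *)

Lemma nat_weights_threshold (R : realType) (V : finType) (G : sgraph V)
    (a : V -> nat) (b : nat) :
  (forall K : {set V}, \sum_(i in K) a i <= b <-> is_clique G K) ->
  is_threshold R G.
Proof.
move=> ab; exists (fun i => (a i)%:R%R), (b%:R)%R => x x01.
pose K := [set i | x i == 1%R].
have xK i : x i = ((i \in K)%:R)%R.
  rewrite inE; case: (x01 i) => ->; rewrite ?eqxx // eq_sym.
  by rewrite GRing.oner_eq0.
have -> : (\sum_i (a i)%:R * x i = (\sum_(i in K) a i)%:R :> R)%R.
  rewrite GRing.natr_sum [RHS]big_mkcond; apply: eq_bigr => i _; rewrite xK.
  by case: (i \in K); rewrite ?GRing.mulr1 ?GRing.mulr0.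
rewrite Num.Theory.ler_nat ab; split=> [cK|[L [cL xL]]]; first by exists K.
suff -> : K = L by [].
apply/setP => i; rewrite inE xL; case: (i \in L); rewrite ?eqxx //.
by rewrite eq_sym GRing.oner_eq0.
Qed.

Section SplitGraph.
Variables (V : finType) (C : pred V) (h : V -> nat).

Definition split_rel : rel V := fun x y =>
  [&& x != y, ~~ (C x && C y), C x ==> (C y || (h y <= h x)) &
      C y ==> (C x || (h x <= h y))].

Lemma split_sym : symmetric split_rel.
Proof.
move=> x y; rewrite /split_rel eq_sym andbC [C y && C x]andbC.
by case: (y != x); case: (C x); case: (C y); rewrite /= ?andbT ?andbF.
Qed.

Lemma split_irr : irreflexive split_rel.
Proof. by move=> x; rewrite /split_rel eqxx. Qed.

Definition split_graph := SGraph split_sym split_irr.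

(** A clique has at most one vertex [x] of [C], and its other vertices weigh at most [B ^ h x] each:
    the weight of [x] leaves room for [n] of them. Conversely, a vertex [y] outside [C] with
    [h y > h x] weighs at least [B * B ^ h x], more than that room. *)
Lemma split_graph_threshold (R : realType) : is_threshold R split_graph.
Proof.
pose n := #|V|; pose B := n.+1; pose N := \max_v h v.
have hN v : h v <= N by exact: leq_bigmax.
have Bmono i j : i <= j -> B ^ i <= B ^ j by move=> ij; rewrite leq_pexp2l.
have B0 i : 0 < B ^ i by rewrite expn_gt0.
(* Two vertices of [C] weigh at least [2 * b - 2 * n * B ^ N], which is [b + B ^ N], so they never
   fit together. *)
pose b := (2 * n).+1 * B ^ N.
pose a v := if C v then b - n * B ^ h v else B ^ h v.
have nBN v : n * B ^ h v <= n * B ^ N by rewrite leq_mul2l Bmono ?orbT.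
have sum_le (K : {set V}) i : (forall v, v \in K -> ~~ C v /\ h v <= i) ->
    \sum_(v in K) a v <= n * B ^ i.
  move=> KC; apply: (@leq_trans (\sum_(v in K) B ^ i)).
    apply: leq_sum => v vK; have [nC le] := KC v vK.
    by rewrite /a (negbTE nC) Bmono.
  by rewrite sum_nat_const leq_mul2r max_card orbT.
apply: (@nat_weights_threshold R _ _ a b) => K; split=> [le_b|clK].
- have two x y : x \in K -> y \in K -> x != y -> a x + a y <= b.
    move=> xK yK xy; apply: leq_trans le_b.
    rewrite (bigD1 x) //= (bigD1 y) /=; last by rewrite yK eq_sym.
    by rewrite addnA leq_addr.
  have mixed x y : x \in K -> y \in K -> x != y -> C x -> ~~ C y -> h y <= h x.
    move=> xK yK xy Cx nCy; rewrite leqNgt; apply/negP => lt.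
    have := two x y xK yK xy; rewrite /a Cx (negbTE nCy) => le.
    have := Bmono _ _ lt; rewrite expnS /B mulSn -/B => le2.
    by have := nBN x; have := B0 (h x); have := B0 N; rewrite /b in le *; nia.
  move=> x y xK yK xy; rewrite /= /split_rel xy /=.
  case Cx: (C x); case Cy: (C y) => //=.
  + have := two x y xK yK xy; rewrite /a Cx Cy.
    by have := nBN x; have := nBN y; have := B0 N; rewrite /b; nia.
  + by rewrite andbT mixed ?Cx ?Cy.
  + by rewrite mixed 1?eq_sym ?Cx ?Cy.
- have [x /andP[xK Cx]|noC] := pickP [pred x in K | C x]; last first.
    apply: (@leq_trans (n * B ^ N)); last by rewrite /b leq_mul2r; lia.
    by apply: sum_le => v vK; split=> //; have := noC v; rewrite /= vK /= => ->.
  rewrite (bigD1 x) //= {1}/a Cx.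
  rewrite (eq_bigl (fun v => v \in K :\ x)); last first.
    by move=> v; rewrite !inE andbC.
  have : \sum_(v in K :\ x) a v <= n * B ^ h x.
    apply: sum_le => v; rewrite !inE => /andP[vx vK].
    have := clK x v xK vK; rewrite eq_sym vx => /(_ isT).
    rewrite /= /split_rel Cx => /and4P[_ nCv].
    by move: nCv => /= /negbTE ->.
  by have := nBN x; have := B0 N; rewrite /b; nia.
Qed.

End SplitGraph.

(** * Threshold graphs of colour classes, and the cover they form *)

Section ColourClassGraph.
Variables (V : finType) (G : sgraph V) (C : pred V) (f : V -> nat) (N : nat).
Hypotheses (fN : forall v, f v <= N).

(** The successor keeps the value 0 for vertices without a neighbour in [C], even if some [f c] is
    0. *)
Definition reach v := \max_(c | C c && G c v) (f c).+1.

Lemma reachP v n : reflect (exists2 c, C c && G c v & n <= f c) (n < reach v).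
Proof.
apply: (iffP idP) => [|[c cv nf]].
  rewrite ltnNge => /bigmax_leqP H; apply: contrapT => nex; apply: H => c cv.
  by rewrite ltnNge; apply/negP => le; apply: nex; exists c.
apply: (leq_trans (n := (f c).+1)); first by [].
exact: (leq_bigmax_cond (F := fun c => (f c).+1)).
Qed.

(* On [C] the weight decreases along [f]; outside [C] it is chosen so that
   [class_weight v <= class_weight c] if and only if [f c < reach v]. *)
Definition class_weight v := if C v then N - f v else N.+1 - reach v.

Definition class_graph := split_graph C class_weight.

Lemma class_graph_mixed c v : C c -> ~~ C v ->
  reflect (exists2 c', C c' && G c' v & f c <= f c') (class_graph c v).
Proof.
move=> Cc nCv; have -> : class_graph c v = (f c < reach v).
  rewrite /= /split_rel /class_weight Cc (negbTE nCv) /= andbT.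
  have -> /= : c != v by apply: contraNneq nCv => <-.
  by have := fN c; lia.
exact: reachP.
Qed.

Lemma class_graph_super : (forall x y, G x y -> ~~ (C x && C y)) ->
  forall x y, G x y -> class_graph x y.
Proof.
move=> indC x y Gxy; have := indC x y Gxy.
case Cx: (C x); case Cy: (C y) => //= _.
- by apply/class_graph_mixed; rewrite ?Cx ?Cy //; exists x; rewrite ?Cx.
- rewrite -[split_rel _ _ _ _]/(class_graph x y) edge_sym.
  by apply/class_graph_mixed; rewrite ?Cx ?Cy //; exists y; rewrite ?Cy 1?edge_sym.
- rewrite /split_rel Cx Cy /= !andbT.
  by apply: contraTneq Gxy => ->; rewrite edge_irr.
Qed.

End ColourClassGraph.

(* The case [v = y] says that the earlier neighbours of a vertex have distinct
   colours. *)
Definition crossing_free (V : finType) (H : rel V) (pos c : V -> nat) :=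
  forall a b v y, H a v -> H b y -> pos a < pos b -> pos b < pos v ->
    pos v <= pos y -> c a != c b.

Lemma threshold_cover_of_colouring (R : realType) (V : finType) (G : sgraph V)
    (k : nat) (pos c : V -> nat) :
  0 < k -> (forall v, c v < k) -> injective pos ->
  (forall x y, G x y -> c x != c y) -> crossing_free G pos c ->
  threshold_cover R G (2 * k).
Proof.
move=> k0 ck posI cG cf; split; first by rewrite muln_gt0.
pose N := \max_v pos v; have posN v : pos v <= N by exact: leq_bigmax.
pose f (r : bool) v := if r then N - pos v else pos v.
have fN r v : f r v <= N by rewrite /f; case: r; rewrite // leq_subr.
pose C n v := c v == n.
(* The index [i] codes a colour by [i./2] and a direction by its parity; [f true] reverses the
   order. *)
pose Gs (i : 'I_(2 * k)) := class_graph G (C i./2) (f (odd i)) N.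
exists Gs; split=> [i|x y]; first exact: split_graph_threshold.
apply/idP/forallP => [Gxy i|all_xy].
  apply: class_graph_super => // {x y Gxy} x y /cG.
  by apply: contra => /andP[/eqP -> /eqP ->].
have inG u (r : bool) x' y' : (forall i, Gs i x' y') ->
    class_graph G (C (c u)) (f r) N x' y'.
  move=> all_i; have lt : r + (c u).*2 < 2 * k.
    by have := ck u; case: r; lia.
  have := all_i (Ordinal lt); rewrite /Gs /= half_bit_double.
  by rewrite oddD odd_double addbF oddb.
wlog xy : x y all_xy / pos x < pos y.
  move=> W; have [lt|lt|/posI e] := ltngtP (pos x) (pos y); first exact: W.
    by rewrite edge_sym; apply: W => // i; rewrite edge_sym.
  have i0 : 0 < 2 * k by rewrite muln_gt0.
  by have := all_xy (Ordinal i0); rewrite e edge_irr.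
apply: contrapT => /negP nG.
(* A colour class is independent in its own graph. *)
have cxy : c x != c y.
  apply/negP => /eqP e; have := inG x false x y all_xy.
  by rewrite /= /split_rel /C e eqxx andbF.
have all_yx i : Gs i y x by rewrite edge_sym.
(* The forward graph of the colour of [y] yields [z] at or after [y], adjacent to [x]. *)
have := inG y false y x all_yx; case/class_graph_mixed => //.
  by rewrite /C eqxx.
move=> z /andP[_ Gzx] /= yz.
(* The backward graph of the colour of [x] yields [w] at or before [x], adjacent to [y]; it is not
   [x], which is not adjacent to [y]. Then [w], [x], [y], [z] violate [crossing_free]. *)
have := inG x true x y all_xy; case/class_graph_mixed => //.
- by rewrite /C eqxx.
- by rewrite /C eq_sym.
move=> w /andP[/eqP cw Gwy]; rewrite /f => wx.
have nwx : pos w != pos x.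
  by apply: contraNneq nG => /posI <-.
have wx' : pos w < pos x by have := posN w; have := posN x; lia.
have := cf w x y z Gwy _ wx' xy yz.
by rewrite cw eqxx edge_sym => /(_ Gzx).
Qed.

(** * Extending the filled graph by a vertex and by a bag *)

Section Fill.
Variables (V : finType) (k : nat).

Record fill (U : {set V}) (H : rel V) (pos c : V -> nat) : Prop := Fill {
  fill_sym : symmetric H;
  fill_dom : forall x y, H x y -> x \in U;
  fill_lt : forall x, x \in U -> c x < k;
  fill_inj : {in U &, injective pos};
  fill_proper : forall x y, H x y -> c x != c y;
  fill_crossing : crossing_free H pos c }.

Definition fillable U H := exists pos c, fill U H pos c.

Definition rel_clique (H : rel V) (K : {set V}) :=
  {in K &, forall x y, x != y -> H x y}.

Definition add_vertex (H : rel V) x (Y : {set V}) : rel V := fun u v =>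
  [|| H u v, (u == x) && (v \in Y) | (v == x) && (u \in Y)].

Lemma fillable_add_vertex (U Y : {set V}) H x :
  fillable U H -> x \notin U -> Y \subset U -> rel_clique H Y -> #|Y| < k ->
  fillable (x |: U) (add_vertex H x Y).
Proof.
move=> [pos [c [symH domH ltc injp prop cf]]] xU YU clY Yk.
(* Fewer than [k] colours occur on [Y], so one is free for [x]. *)
have [col colk colY] : exists2 i, i < k & forall y, y \in Y -> c y != i.
  have [i ni|all_i] := pickP (fun i : 'I_k => [forall y in Y, c y != i]).
    by exists i => // y; move/forall_inP: ni; apply.
  suff : k <= #|Y| by rewrite leqNgt Yk.
  have sub : {subset iota 0 k <= [seq c y | y in Y]}.
    move=> i; rewrite mem_iota /= => ik; have := all_i (Ordinal ik).
    move/negbT; rewrite negb_forall_in => /exists_inP[y yY /negPn/eqP /= <-].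
    exact: image_f.
  by have := uniq_leq_size (iota_uniq 0 k) sub; rewrite size_iota size_image.
pose M := \max_(y in Y) (pos y).+1.
have MP p : p < M -> exists2 m, m \in Y & p <= pos m.
  rewrite ltnNge => /bigmax_leqP nM; apply: contrapT => nex; apply: nM => m mY.
  by rewrite ltnNge; apply/negP => le; apply: nex; exists m.
have ltM y : y \in Y -> pos y < M by move=> yY; exact: leq_bigmax_cond.
(* Old positions become even and at least 2, so the odd value is free: it lies just after the last
   vertex of [Y], or before every old vertex when [Y] is empty and [M] is 0. *)
pose pos' v := if v == x then M.*2.+1 else (pos v).+1.*2.
pose c' v := if v == x then col else c v.
have Ux v : v \in U -> (v == x) = false.
  by move=> vU; apply: contraNF xU => /eqP <-.
have Yx v : v \in Y -> (v == x) = false by move=> vY; rewrite Ux ?(subsetP YU).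
have domH2 u v : H u v -> v \in U by rewrite symH => /domH.
have HxF v : H x v = false by apply: contraNF xU => /domH.
have HFx v : H v x = false by rewrite symH.
have addx v : add_vertex H x Y x v = (v \in Y).
  have xY : (x \in Y) = false by apply: contraNF xU => /(subsetP YU).
  by rewrite /add_vertex HxF eqxx xY andbF orbF.
have addsym : symmetric (add_vertex H x Y).
  by move=> u v; rewrite /add_vertex symH; case: (H v u); rewrite //= orbC.
have addxr v : add_vertex H x Y v x = (v \in Y) by rewrite addsym addx.
have addo u v : u == x = false -> v == x = false -> add_vertex H x Y u v = H u v.
  by move=> eu ev; rewrite /add_vertex eu ev /= !orbF.
exists pos', c'; split=> //.
- move=> u v /or3P[/domH uU|/andP[/eqP -> _]|/andP[_ uY]]; rewrite !inE.
  + by rewrite uU orbT.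
  + by rewrite eqxx.
  + by rewrite (subsetP YU) ?orbT.
- move=> u; rewrite !inE /c'; case: eqP => //= _; exact: ltc.
- move=> u v; rewrite !inE /pos'; case: eqP => [->|_]; case: eqP => [->|_] //=.
  + by move=> _ _; lia.
  + by move=> _ _; lia.
  + by move=> uU vU e; apply: injp => //; lia.
- move=> u v; rewrite /c'; case: (eqVneq u x) => [->|/negbTE ux].
    by rewrite addx => vY; rewrite (Yx v vY) eq_sym colY.
  case: (eqVneq v x) => [->|/negbTE vx]; first by rewrite addxr; exact: colY.
  by rewrite addo //; exact: prop.
- move=> a b v y; rewrite /pos' /c'.
  have cY u u' : u \in Y -> u' \in Y -> pos u < pos u' -> c u != c u'.
    move=> uY uY' lt; apply: prop; apply: clY => //.
    by apply: contraTneq lt => ->; rewrite ltnn.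
  have HY u u' : u \in Y -> u' \in Y -> pos u < pos u' -> H u u'.
    move=> uY uY' lt; apply: clY => //.
    by apply: contraTneq lt => ->; rewrite ltnn.
  (* Both [a] and [b] precede a neighbour, whereas [x] comes after all of its own. *)
  case: (eqVneq a x) => [->|/negbTE ax].
    by rewrite addx => vY; rewrite (Yx v vY); have := ltM v vY; lia.
  case: (eqVneq b x) => [->|/negbTE bx].
    by rewrite addx => _ yY; rewrite (Yx y yY); have := ltM y yY; lia.
  (* If [v] is [x] and [y] is old, some [m] in [Y] is at or after [b]. If strictly after, [m]
     replaces [v], being adjacent to [a] in the clique [Y]; if [m] is [b], then [a] and [b] both lie
     in [Y] and differ in colour. *)
  case: (eqVneq v x) => [->|/negbTE vx].
    rewrite addxr => aY; case: (eqVneq y x) => [->|/negbTE yx].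
      by rewrite addxr => bY lt _ _; apply: cY => //; lia.
    rewrite addo // => Hby ab bM My.
    have [|m mY bm] := MP (pos b); first by lia.
    have [bm'|mb] := ltnP (pos b) (pos m).
      apply: (cf a b m y) => //; first by apply: HY => //; lia.
      + by lia.
      + by have := ltM m mY; lia.
    have -> : b = m.
      by apply: injp; rewrite ?(subsetP YU m mY) ?(domH _ _ Hby) //; lia.
    by apply: cY => //; lia.
  (* If only [y] is [x], a vertex [m] of [Y] at or after [v] replaces it. *)
  rewrite addo // => Hav; case: (eqVneq y x) => [->|/negbTE yx].
    rewrite addxr => bY ab bv vM.
    have [|m mY vm] := MP (pos v); first by lia.
    by apply: (cf a b v m) => //; first (by apply: HY => //; lia); lia.
  by rewrite addo // => Hby ab bv vy; apply: (cf a b v y) => //; lia.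
Qed.

(** The missing vertices of [X] are added one by one, each joined to the part of [X] already
    present: a clique with fewer than [k] vertices, since it misses the new one. *)
Lemma fillable_add_bag (U X : {set V}) H :
  fillable U H -> #|X| <= k -> rel_clique H (X :&: U) ->
  exists H', [/\ fillable (X :|: U) H', subrel H H' & rel_clique H' X].
Proof.
move=> fUH Xk; have [n] := ubnP #|X :\: U|; elim: n U H fUH => // n IH U H fUH.
move=> lt_n clX.
have [/eqP|[x xXU]] := set_0Vmem (X :\: U).
  rewrite setD_eq0 => XU; exists H; split=> //.
    by rewrite (setUidPr XU).
  by move: clX; rewrite (setIidPl XU).
have [xX xU] : x \in X /\ x \notin U by move: xXU; rewrite inE => /andP[].
have YU : X :&: U \subset U by exact: subsetIr.
have Yk : #|X :&: U| < k.
  apply: leq_trans Xk; apply: proper_card; apply/properP; split.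
    exact: subsetIl.
  by exists x => //; rewrite inE xX.
have f1 := fillable_add_vertex fUH xU YU clX Yk.
have [||H' [f' sub cl]] := IH _ _ f1.
- rewrite -ltnS; apply: leq_trans lt_n; rewrite ltnS; apply: proper_card.
  apply/properP; split; first by apply: setDS; exact: subsetUr.
  by exists x => //; rewrite !inE eqxx.
- move=> u v; rewrite !inE /add_vertex => /andP[uX] /orP[/eqP ->|uU].
    move=> /andP[vX] /orP[/eqP ->|vU]; first by rewrite eqxx.
    by rewrite eqxx !inE vX vU /= orbT.
  move=> /andP[vX] /orP[/eqP ->|vU]; first by rewrite eqxx !inE uX uU /= !orbT.
  by move=> uv; rewrite clX ?inE ?uX ?vX.
exists H'; split=> //.
  suff <- : X :|: (x |: U) = X :|: U by [].
  apply/setP => u; rewrite !inE.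
  by case: (eqVneq u x) => [->|]; rewrite ?xX.
by move=> u v uv; apply: sub; rewrite /add_vertex uv.
Qed.

End Fill.

(** * Filling the bags along a growing connected set of nodes *)

Section TreeDecomposition.
Variables (V T : finType) (G : sgraph V) (F : sgraph T) (X : T -> {set V}).
Hypothesis decX : is_tree_decomposition G F X.
Variable k : nat.
Hypothesis Xk : forall t, #|X t| <= k.

Definition path_connected (S : {set T}) :=
  {in S &, forall i j, exists p, [/\ path F i p, uniq (i :: p), last i p = j &
     {subset i :: p <= S}]}.

Definition filled (S : {set T}) := exists H : rel V,
  fillable k (\bigcup_(t in S) X t) H /\ {in S, forall t, rel_clique H (X t)}.

(** A simple path inside [S] to [s] stays simple when extended by [t], so convexity of the
    decomposition applies to it at [s]. *)
Lemma bag_inter S s t : path_connected S -> s \in S -> t \notin S -> F s t ->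
  X t :&: (\bigcup_(i in S) X i) \subset X s.
Proof.
case: decX => _ _ _ convX conS sS tS Fst; apply/subsetP => v; rewrite inE.
case/andP=> vt /bigcupP[i iS vi].
have [p [pp up lp pS]] := conS i s iS sS.
have := convX i t (rcons p t); rewrite rcons_path pp lp Fst -rcons_cons.
rewrite rcons_uniq up (contra (pS t) tS) last_rcons => /(_ isT isT erefl s).
rewrite mem_rcons inE -lp mem_last orbT => /(_ isT)/subsetP; apply.
by rewrite inE vi vt.
Qed.

Lemma path_connected_add S s t :
  path_connected S -> s \in S -> t \notin S -> F s t -> path_connected (t |: S).
Proof.
move=> conS sS tS Fst i j; rewrite !inE.
have St u : u \in S -> u \in t |: S by rewrite inE => ->; rewrite orbT.
case/orP=> [/eqP ->|iS]; case/orP=> [/eqP ->|jS].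
- by exists [::]; split=> // u; rewrite !inE => ->.
- have [p [pp up lp pS]] := conS s j sS jS; exists (s :: p); split=> //.
  + by rewrite /= edge_sym Fst.
  + by rewrite cons_uniq up andbT (contra (pS t)).
  + by move=> u; rewrite inE => /orP[/eqP ->|/pS/St]; rewrite // !inE eqxx.
- have [p [pp up lp pS]] := conS i s iS sS; exists (rcons p t); split.
  + by rewrite rcons_path pp lp.
  + by rewrite -rcons_cons rcons_uniq up andbT (contra (pS t)).
  + by rewrite last_rcons.
  + move=> u; rewrite -rcons_cons mem_rcons inE.
    by case/orP=> [/eqP ->|/pS/St]; rewrite // !inE eqxx.
- by have [p [pp up lp pS]] := conS i j iS jS; exists p; split=> // u /pS/St.
Qed.

(** The hypothesis ranges over every [H] because the one provided by [filled S] is hidden by the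
    existential. *)
Lemma filled_add S t : filled S ->
  (forall H, {in S, forall t, rel_clique H (X t)} ->
     rel_clique H (X t :&: \bigcup_(i in S) X i)) ->
  filled (t |: S).
Proof.
move=> [H [fH clH]] clt.
have [H' [f' sub cl']] := fillable_add_bag fH (Xk t) (clt H clH).
exists H'; split.
  suff -> : \bigcup_(i in t |: S) X i = X t :|: \bigcup_(i in S) X i by [].
  by rewrite bigcup_setU big_set1.
move=> i; rewrite !inE => /orP[/eqP -> //|iS] u v uX vX uv.
by apply: sub; exact: (clH i iS).
Qed.

Lemma crossing_edge (S : {set T}) i : i \in S -> S != setT ->
  exists s t, [/\ s \in S, t \notin S & F s t].
Proof.
case: decX => -[_ conF _] _ _ _ iS nS.
have [j jS] : exists j, j \notin S.
  apply/existsP; apply: contraNT nS => /existsPn h; apply/eqP/setP => j.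
  by rewrite inE; have := h j; rewrite negbK.
have /connectP[p] := conF i j.
elim: p i iS => [|u p IH] i iS /=; first by move=> _ e; rewrite e iS in jS.
case/andP=> Fiu pu lj; case: (boolP (u \in S)) => uS; first exact: (IH u).
by exists i, u.
Qed.

(** Nodes are added one at a time across an edge [F s t] leaving [S]; by [bag_inter] the old part of
    the new bag lies in [X s], already a clique. *)
Lemma filledT : filled setT.
Proof.
suff H n : n < #|T| ->
    exists S : {set T}, [/\ #|S| = n.+1, path_connected S & filled S].
  case: (decX) => -[T0 _ _] _ _ _.
  have [|S [cS _ fS]] := H #|T|.-1; first by rewrite prednK.
  suff e : S = setT by rewrite -e.
  by apply/eqP; rewrite eqEcard subsetT cardsT cS prednK ?leqnn.
elim: n => [/card_gt0P[t _]|n IH nT].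
  exists [set t]; split; first by rewrite cards1.
  - move=> i j; rewrite !inE => /eqP -> /eqP ->; exists [::]; split=> //.
    by move=> u; rewrite !inE.
  (* The first bag is added to the edgeless graph on no vertices. *)
  - rewrite -[[set t]]setU0; apply: filled_add; last first.
      by move=> H _ u v; rewrite big_set0 setI0 inE.
    exists (fun _ _ => false); split; last by move=> i; rewrite inE.
    by exists (fun=> 0), (fun=> 0); rewrite big_set0; split=> // u; rewrite inE.
have [S [cS conS fS]] := IH (ltnW nT).
have [i iS] : exists i, i \in S by apply/card_gt0P; rewrite cS.
have nS : S != setT.
  by apply: contraTneq nT => e; rewrite -leqNgt -cS e cardsT.
have [s [t [sS tS Fst]]] := crossing_edge iS nS.
exists (t |: S); split; first by rewrite cardsU1 tS cS.
- exact: path_connected_add Fst.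
apply: filled_add => // H clH u v uX vX.
have /subsetP sub := bag_inter conS sS tS Fst.
exact: (clH s sS) (sub u uX) (sub v vX).
Qed.

(** Every edge of [G] lies in a bag, hence in [H], and both colouring conditions pass to
    subgraphs. *)
Lemma decomposition_colouring : exists pos c : V -> nat,
  [/\ forall v, c v < k, injective pos, forall x y, G x y -> c x != c y &
      crossing_free G pos c].
Proof.
have [H [[pos [c [_ _ ltc injp prop cf]]] cl]] := filledT.
case: decX => _ covX edgX _.
have allU v : v \in \bigcup_(t in setT) X t.
  suff -> : \bigcup_(t in setT) X t = setT by rewrite inE.
  by rewrite -covX; apply: eq_bigl => t; rewrite inE.
have GH x y : G x y -> H x y.
  move=> Gxy; have [t [xt yt]] := edgX x y Gxy; apply: (cl t) => //.
  by apply: contraTneq Gxy => ->; rewrite edge_irr.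
exists pos, c; split=> [v|x y|x y /GH|a b v y /GH av /GH by_].
- exact: ltc.
- exact: injp.
- exact: prop.
- exact: cf by_.
Qed.

End TreeDecomposition.

Theorem theorem4 (R : realType) (V : finType) (G : sgraph V) :
  threshold_dim R G <= 2 * (treewidth G + 1).
Proof.
rewrite /treewidth; case: ex_minnP => w /asboolP[T [F [X [decX wX]]]] _.
have Xw t : #|X t| <= w + 1.
  (* The truncated predecessor still gives the bound when all bags are empty. *)
  have := leq_bigmax (F := fun i => #|X i|) t.
  by move: wX; rewrite /bags_width; lia.
have [pos [c [ck posI cG cf]]] := decomposition_colouring decX Xw.
rewrite /threshold_dim; case: ex_minnP => d _; apply; apply/asboolP.
by apply: threshold_cover_of_colouring cf => //; rewrite addn1.
Qed.
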